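(* Let $\eta\in(0,1/2)$. For all integers $d\ge2$, $N\ge1$ and every point $\mathbf a\in\mathbb R^d$, $$\frac{1}{\#\mathcal W}\#\Bigl\{\mathbf v\in\mathcal W:\operatorname{dist}_d(\mathbf a,\mathbf v)\in\Bigl[\sqrt{B_{\mathbf a,\mathcal W}}-\tfrac1{d^\eta},\sqrt{B_{\mathbf a,\mathcal W}}+\tfrac1{d^\eta}\Bigr]\Bigr\}\ge1-\frac{51}{15}\cdot\frac{1}{d^{1-2\eta}}.$$
   Context: $\mathcal W=\{0,1,\dots,N\}^d$. $\operatorname{dist}_d(\mathbf u,\mathbf v)=\frac{1}{\sqrt d\,N}\bigl(\sum_j(u_j-v_j)^2\bigr)^{1/2}$. $B_{\mathbf a,\mathcal W}=\frac{1}{\#\mathcal W}\sum_{\mathbf v\in\mathcal W}\operatorname{dist}_d^2(\mathbf a,\mathbf v)=\frac13+\frac1{6N}-\frac{a_1+\cdots+a_d}{dN}+\frac{a_1^2+\cdots+a_d^2}{dN^2}$. *)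

(* Defs.v *)
From mathcomp Require Export all_boot all_order all_algebra.
From mathcomp Require Export reals exp.

Set Implicit Arguments.
Unset Strict Implicit.
Unset Printing Implicit Defensive.

Import Order.TTheory GRing.Theory Num.Theory.
Local Open Scope ring_scope.

Notation grid d N := {ffun 'I_d -> 'I_N.+1}.

Definition grid_pt (R : realType) (d N : nat) (v : grid d N) : 'rV[R]_d :=
  \row_j (v j : nat)%:R.

Definition distd (R : realType) (d N : nat) (u v : 'rV[R]_d) : R :=
  (Num.sqrt d%:R * N%:R)^-1 * Num.sqrt (\sum_(j < d) (u 0 j - v 0 j) ^+ 2).

Definition avg_sqdist (R : realType) (d N : nat) (a : 'rV[R]_d) : R :=
  #|{: grid d N}|%:R^-1 * \sum_(v : grid d N) distd N a (grid_pt R v) ^+ 2.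

(* Main.v *)
Require Import Defs.
From mathcomp Require Import all_boot all_order all_algebra.
From mathcomp Require Import reals exp.
From mathcomp Require Import ring lra.

Set Implicit Arguments.
Unset Strict Implicit.
Unset Printing Implicit Defensive.

Import Order.TTheory GRing.Theory Num.Theory.
Local Open Scope ring_scope.

(** Write [D] for the distance from [a] to a uniform grid point and [B] for the
    mean of [D ^+ 2].  Since [`|D ^+ 2 - B| >= `|D - sqrt B| * sqrt B], Chebyshev
    bounds the probability of [`|D - sqrt B| > t] by [Var (D ^+ 2) / (t ^+ 2 * B)].
    The coordinates are independent, so [d * Var (D ^+ 2)] and [B] are the averages
    over [j] of the variance and of the mean of [X j = (a j - v j) ^+ 2 / N ^+ 2].
    Two values of [v j / N] differ by at most [1], so two values [x], [y] of [X j]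
    satisfy [(x - y) ^+ 2 <= 2 * (x + y)]; averaging over independent pairs gives
    [Var (X j) <= 2 * E (X j)] wherever [a] lies, and [2 <= 51 / 15]. *)

Section UniformMean.
Variable R : realType.

Definition mean (T : finType) (f : T -> R) : R := #|T|%:R^-1 * \sum_x f x.

Section OneSpace.
Variable T : finType.
Implicit Types f g h : T -> R.

Lemma eq_mean f g : f =1 g -> mean f = mean g.
Proof. by move=> fg; congr (_ * _); apply: eq_bigr => x _. Qed.

Lemma meanD f g : mean (fun x => f x + g x) = mean f + mean g.
Proof. by rewrite /mean big_split mulrDr. Qed.

Lemma meanZ c f : mean (fun x => c * f x) = c * mean f.
Proof. by rewrite /mean -mulr_sumr mulrCA. Qed.

Lemma mean_sum (I : finType) (F : I -> T -> R) :
  mean (fun x => \sum_i F i x) = \sum_i mean (F i).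
Proof. by rewrite /mean exchange_big mulr_sumr. Qed.

Lemma ler_mean f g : (forall x, f x <= g x) -> mean f <= mean g.
Proof. by move=> fg; rewrite ler_wpM2l ?invr_ge0 ?ler0n ?ler_sum. Qed.

Hypothesis T_gt0 : (0 < #|T|)%N.

Lemma mean_const c : mean (fun _ : T => c) = c.
Proof.
by rewrite /mean sumr_const -[c *+ _]mulr_natl mulKf // pnatr_eq0 -lt0n.
Qed.

Lemma mean_eq0 f : (forall x, 0 <= f x) -> mean f = 0 -> forall x, f x = 0.
Proof.
move=> f_ge0 /eqP; rewrite mulf_eq0 invr_eq0 pnatr_eq0 -[_ == 0%N]negbK -lt0n T_gt0.
by move=> /eqP f0 x; apply: (psumr_eq0P (fun y _ => f_ge0 y) f0).
Qed.

(** Expanding the squares, both sides equal [2 * (q - m ^+ 2)], where [m] is the mean of [f] and [q]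
    that of its square. *)
Lemma variance_pairs f :
  mean (fun x => mean (fun y => (f x - f y) ^+ 2)) =
  2 * mean (fun x => (f x - mean f) ^+ 2).
Proof.
set m := mean f; set q := mean (fun x => f x ^+ 2).
have meanB c : mean (fun y => (c - f y) ^+ 2) = c ^+ 2 + (- (2 * c)) * m + q.
  rewrite -meanZ -[c ^+ 2]mean_const -!meanD.
  by apply: eq_mean => y; ring.
have -> : mean (fun x => (f x - m) ^+ 2) = mean (fun x => (m - f x) ^+ 2).
  by apply: eq_mean => x; ring.
rewrite (eq_mean (fun x => meanB (f x))) meanB !meanD mean_const -/q.
rewrite (eq_mean (g := fun x => - (2 * m) * f x)) ?meanZ; last by move=> x; ring.
by rewrite -/m; ring.
Qed.

(** Averaging the hypothesis over [x] and [y] turns its left side into twice the variance and its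
    right side into [4 * mean h]. *)
Lemma variance_le f h :
    (forall x y, (f x - f y) ^+ 2 <= 2 * (h x + h y)) ->
  mean (fun x => (f x - mean f) ^+ 2) <= 2 * mean h.
Proof.
move=> fh; rewrite -(@ler_pM2l _ 2) // -variance_pairs.
apply: (le_trans (ler_mean (g := fun x => 2 * h x + 2 * mean h) _)).
  move=> x; apply: (le_trans (ler_mean (fh x))).
  by rewrite meanZ meanD mean_const mulrDr.
by rewrite meanD mean_const meanZ; lra.
Qed.

(* Chebyshev for [D ^+ 2], read off for [D] itself. *)
Lemma sqrt_mean_concentration (D : T -> R) (t K : R) :
    0 < t -> (forall x, 0 <= D x) ->
    let B := mean (fun x => D x ^+ 2) in
    mean (fun x => (D x ^+ 2 - B) ^+ 2) <= K * B -> 0 <= K ->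
  mean (fun x => (~~ (`|D x - Num.sqrt B| <= t))%:R) <= K / t ^+ 2.
Proof.
move=> t_gt0 D_ge0 B var_le K_ge0.
have B_ge0 : 0 <= B.
  by rewrite mulr_ge0 ?invr_ge0 ?ler0n ?sumr_ge0 // => x _; rewrite sqr_ge0.
(* If [B = 0], then [D] vanishes identically and no point deviates; otherwise [B] can be
   cancelled. *)
have [B0|B_neq0] := eqVneq B 0.
  rewrite (eq_mean (g := fun=> 0)) ?mean_const ?divr_ge0 ?sqr_ge0 // => x.
  have /eqP := mean_eq0 (fun x => sqr_ge0 (D x)) B0 x.
  by rewrite sqrf_eq0 B0 sqrtr0 subr0 => /eqP ->; rewrite normr0 ltW.
have B_gt0 : 0 < B by rewrite lt_def B_neq0.
rewrite ler_pdivlMr ?exprn_gt0 // -(ler_pM2r B_gt0) -mulrA mulrC.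
apply: le_trans var_le; rewrite -meanZ; apply: ler_mean => x.
have [_|dev] /= := leP `|_| t; first by rewrite mulr0 sqr_ge0.
(* Factor [D x ^+ 2 - B] as [(D x - sqrt B) * (D x + sqrt B)]: the first factor exceeds [t] in
   absolute value, the second is at least [sqrt B]. *)
rewrite mulr1 -[X in _ - X](sqr_sqrtr B_ge0) subr_sqr exprMn.
rewrite -[X in t ^+ 2 * X](sqr_sqrtr B_ge0).
apply: ler_pM; rewrite ?sqr_ge0 //.
  rewrite -[leRHS]real_normK ?num_real // ler_pXn2r ?nnegrE ?normr_ge0 //.
    exact: ltW.
  exact: ltW.
by rewrite ler_pXn2r ?nnegrE ?addr_ge0 ?sqrtr_ge0 // lerDr.
Qed.

End OneSpace.

Section ProductSpace.
Variables I T : finType.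
Hypothesis T_gt0 : (0 < #|T|)%N.

(** This is independence of the coordinates: distributing a product of sums over [I] gives one term
    for each function [v]. *)
Lemma mean_prod (F : I -> T -> R) :
  mean (fun v : {ffun I -> T} => \prod_i F i (v i)) = \prod_i mean (F i).
Proof.
rewrite /mean big_split /= prodr_const card_ffun natrX exprVn.
by rewrite bigA_distr_bigA.
Qed.

Lemma mean_coord i (f : T -> R) : mean (fun v : {ffun I -> T} => f (v i)) = mean f.
Proof.
(* Constant factors [1] away from [i] have mean [1] and drop out on both sides. *)
have := mean_prod (fun l x => if l == i then f x else 1).
rewrite (bigD1 i) //= eqxx [X in _ * X]big1 ?mulr1 => [<-|l /negbTE ->].
  apply: eq_mean => v; rewrite (bigD1 i) //= eqxx big1 ?mulr1 // => l.
  by move/negbTE ->.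
exact: mean_const.
Qed.

Lemma mean_coord_mul i j (f g : T -> R) : i != j ->
  mean (fun v : {ffun I -> T} => f (v i) * g (v j)) = mean f * mean g.
Proof.
move=> ij; have ji : j != i by rewrite eq_sym.
have := mean_prod (fun l x => if l == i then f x else if l == j then g x else 1).
rewrite (bigD1 i) //= eqxx (bigD1 j) //= (negbTE ji) eqxx.
rewrite [X in _ * (_ * X)]big1 ?mulr1 => [<-|l /andP[/negbTE -> /negbTE ->]].
  apply: eq_mean => v; rewrite (bigD1 i) //= eqxx (bigD1 j) //= (negbTE ji) eqxx.
  by rewrite big1 ?mulr1 // => l /andP[/negbTE -> /negbTE ->].
exact: mean_const.
Qed.

(** After centring, each off-diagonal term of the expanded square has mean [0] by independence, so
    only the diagonal survives. *)
Lemma variance_sum (F : I -> T -> R) :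
  mean (fun v : {ffun I -> T} => (\sum_i F i (v i) - \sum_i mean (F i)) ^+ 2) =
  \sum_i mean (fun x => (F i x - mean (F i)) ^+ 2).
Proof.
pose Y i x := F i x - mean (F i).
have meanY i : mean (Y i) = 0 by rewrite /Y meanD mean_const ?subrr.
rewrite (eq_mean (g := fun v : {ffun I -> T} =>
    \sum_i \sum_j Y i (v i) * Y j (v j))); last first.
  by move=> v; rewrite -sumrB expr2 big_distrlr.
rewrite mean_sum; apply: eq_bigr => i _; rewrite mean_sum (bigD1 i) //=.
rewrite [X in _ + X]big1 ?addr0 => [|j ji].
  by rewrite (mean_coord i (fun x => Y i x * Y i x)); apply: eq_mean => x; rewrite -expr2.
by rewrite mean_coord_mul 1?eq_sym // !meanY mulr0.
Qed.

End ProductSpace.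
End UniformMean.

Section GridDistance.
Variables (R : realType) (d N : nat) (a : 'rV[R]_d).
Hypotheses (d_gt0 : (0 < d)%N) (N_gt0 : (0 < N)%N).

Let dR_gt0 : 0 < d%:R :> R. Proof. by rewrite ltr0n. Qed.
Let NR_gt0 : 0 < N%:R :> R. Proof. by rewrite ltr0n. Qed.

Let X (j : 'I_d) (k : 'I_N.+1) : R := ((a 0 j - k%:R) / N%:R) ^+ 2.

Lemma distd_sqr (v : grid d N) :
  distd N a (grid_pt R v) ^+ 2 = d%:R^-1 * \sum_j X j (v j).
Proof.
rewrite /distd exprMn sqr_sqrtr ?sumr_ge0 // => [|j _]; last exact: sqr_ge0.
rewrite exprVn exprMn sqr_sqrtr ?ler0n // invfM -mulrA; congr (_ * _).
rewrite mulr_sumr; apply: eq_bigr => j _.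
by rewrite /X exprMn exprVn mxE mulrC.
Qed.

Lemma avg_sqdistE : avg_sqdist N a = d%:R^-1 * \sum_j mean (X j).
Proof.
rewrite -[LHS]/(mean (fun v : grid d N => distd N a (grid_pt R v) ^+ 2)).
rewrite (eq_mean distd_sqr) meanZ mean_sum; congr (_ * _).
by apply: eq_bigr => j _; rewrite mean_coord // card_ord.
Qed.

Lemma variance_coord_le j : mean (fun k => (X j k - mean (X j)) ^+ 2) <= 2 * mean (X j).
Proof.
apply: variance_le => [|k l]; first by rewrite card_ord.
have grid01 (i : 'I_N.+1) : 0 <= (i%:R / N%:R : R) <= 1.
  by rewrite divr_ge0 ?ler0n //= ler_pdivrMr // mul1r ler_nat -ltnS.
rewrite /X !mulrBl; move: (grid01 k) (grid01 l).
set x := k%:R / _; set y := l%:R / _; set c := a 0 j / _ => kx ly.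
have -> : ((c - x) ^+ 2 - (c - y) ^+ 2) ^+ 2 =
    (x - y) ^+ 2 * ((c - x) + (c - y)) ^+ 2 by ring.
have xy_le1 : (x - y) ^+ 2 <= 1 by nra.
apply: (le_trans (ler_wpM2r (sqr_ge0 _) xy_le1)); rewrite mul1r.
by have := sqr_ge0 ((c - x) - (c - y)); nra.
Qed.

(** The scaling by [1 / d] enters the variance squared; one factor turns the sum of the coordinate
    means into [avg_sqdist], the other remains in the bound. *)
Lemma variance_sqdist_le :
  mean (fun v : grid d N => (distd N a (grid_pt R v) ^+ 2 - avg_sqdist N a) ^+ 2)
    <= 2 / d%:R * avg_sqdist N a.
Proof.
rewrite avg_sqdistE.
rewrite (eq_mean (g := fun v : grid d N => d%:R^-1 ^+ 2 *
    (\sum_j X j (v j) - \sum_j mean (X j)) ^+ 2)); last first.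
  by move=> v; rewrite distd_sqr -mulrBr exprMn.
rewrite meanZ variance_sum ?card_ord // expr2.
rewrite [2 / _]mulrC -!mulrA !ler_pM2l ?invr_gt0 // [leRHS]mulrCA ler_pM2l ?invr_gt0 //.
by rewrite mulr_sumr; apply: ler_sum => j _; exact: variance_coord_le.
Qed.

End GridDistance.

Theorem theorem6p1 (R : realType) (eta : R) (heta : 0 < eta < 1 / 2)
    (d N : nat) (hd : (2 <= d)%N) (hN : (1 <= N)%N) (a : 'rV[R]_d) :
  #|{: grid d N}|%:R^-1 *
    #|[set v : grid d N |
        distd N a (grid_pt R v) \in
          `[Num.sqrt (avg_sqdist N a) - 1 / d%:R `^ eta,
            Num.sqrt (avg_sqdist N a) + 1 / d%:R `^ eta]]|%:R
  >= 1 - 51 / 15 * (1 / d%:R `^ (1 - 2 * eta)).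
Proof.
have d_gt0 : (0 < d)%N by exact: ltnW.
have dR_gt0 : 0 < d%:R :> R by rewrite ltr0n.
have grid_gt0 : (0 < #|{: grid d N}|)%N by rewrite card_ffun card_ord expn_gt0.
set t : R := 1 / d%:R `^ eta.
have t_gt0 : 0 < t by rewrite divr_gt0 ?powR_gt0.
set S := [set _ | _].
pose D (v : grid d N) := distd N a (grid_pt R v).
have D_ge0 v : 0 <= D v by rewrite mulr_ge0 ?invr_ge0 ?mulr_ge0 ?sqrtr_ge0 ?ler0n.
have K_ge0 : 0 <= 2 / d%:R :> R by rewrite divr_ge0 ?ler0n.
have := sqrt_mean_concentration grid_gt0 t_gt0 D_ge0
  (variance_sqdist_le a d_gt0 hN) K_ge0.
have -> : mean (fun v => D v ^+ 2) = avg_sqdist N a by [].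
have memS v : (v \in S) = (`|D v - Num.sqrt (avg_sqdist N a)| <= t).
  by rewrite inE in_itv /= -ler_distlC distrC.
(* Pass from the deviating points to their complement [S], in a form to which linearity of [mean]
   applies. *)
rewrite (eq_mean (g := fun v => 1 + -1 * (v \in S)%:R)); last first.
  by move=> v; rewrite -memS; case: (v \in S) => /=; ring.
rewrite meanD mean_const // meanZ.
have -> : mean (fun v => (v \in S)%:R : R) = #|{: grid d N}|%:R^-1 * #|S|%:R.
  rewrite /mean -sum1_card natr_sum [in RHS]big_mkcond; congr (_ * _).
  by apply: eq_bigr => v _; case: (v \in S).
have -> : 2 / d%:R / t ^+ 2 = 2 * (1 / d%:R `^ (1 - 2 * eta)).
  have -> : d%:R `^ (1 - 2 * eta) = d%:R / (d%:R `^ eta) ^+ 2.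
    rewrite powRB; last by apply/implyP => _; rewrite gt_eqF.
    by rewrite powRr1 ?ler0n // [2 * eta]mulrC powRrM powR_mulrn ?powR_ge0.
  by rewrite /t !div1r exprVn invrK invf_div mulrAC -mulrA.
(* Nonnegativity of this power allows the constant [2] to be weakened to [51 / 15]. *)
have : 0 <= 1 / d%:R `^ (1 - 2 * eta) by rewrite divr_ge0 ?powR_ge0.
set P := 1 / _; set Q := _ * #|S|%:R; lra.
Qed.
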